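(* Let $n\geq 2$, let $V_1,\ldots,V_n$ be pairwise disjoint sets with $|V_1|=\cdots=|V_n|=n$, and let $\Omega\subseteq V_1\times\cdots\times V_n$ be an octahedral system. If $k\geq 1$ of the classes $V_i$ are covered in $\Omega$, then $|\Omega|\geq k(n-2)+2$.
   Context: An octahedral system is a set $\Omega\subseteq V_1\times\cdots\times V_n$ such that $|\Omega\cap(X_1\times\cdots\times X_n)|$ is even whenever $X_i\subseteq V_i$ and $|X_i|=2$ for all $i$. The $V_i$ are called classes. A class $V_i$ is covered in $\Omega$ if for every $x\in V_i$ there is an element of $\Omega$ whose $i$th component is $x$. *)

(* Defs.v *)
From mathcomp Require Import all_boot.

Set Implicit Arguments.
Unset Strict Implicit.
Unset Printing Implicit Defensive.

Section OctahedralSystem.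

Variables (T : finType) (n : nat).

(* An n-tuple (x_1, ..., x_n) of elements of T is a finite function on 'I_n,
   with 0-based indices. *)
Definition class_prod (V : 'I_n -> {set T}) : {set {ffun 'I_n -> T}} :=
  [set f : {ffun 'I_n -> T} | [forall i, f i \in V i]].

Definition octahedral_system (V : 'I_n -> {set T})
    (Omega : {set {ffun 'I_n -> T}}) : Prop :=
  Omega \subset class_prod V /\
  forall X : 'I_n -> {set T},
    (forall i, X i \subset V i) -> (forall i, #|X i| = 2) ->
    ~~ odd #|Omega :&: class_prod X|.

Definition class_covered (V : 'I_n -> {set T})
    (Omega : {set {ffun 'I_n -> T}}) (i : 'I_n) : Prop :=
  forall x, x \in V i -> exists2 f, f \in Omega & f i = x.

End OctahedralSystem.

(* Main.v *)
(** Induct on the number of coordinates. An octahedral system is a disjoint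
union of "perfect" ones, which cover every coordinate that they do not keep
constant, so it is enough to show that a perfect system P with k nonconstant
coordinates, classes of size m >= k, has at least k(m-2)+2 elements.

Choose a nonconstant coordinate i and x in V_i of minimal degree d, with link L.
The link of y in V_i differs from L by an octahedral system o_y with fewer
coordinates, so its size is d + |o_y| - 2|o_y meet L|. If some other coordinate
j of P is constant on every piece of every o_y, then the fibers of P over V_j
are octahedral and |P| >= m^2; the same bound holds if d >= m. Otherwise at most
k-1 of the o_y have pieces which together vary in all the coordinates of P but i.
The overlap of L with these pieces is bounded by counting the classes of L
modulo the set C of coordinates used so far: a piece varying in coordinates
outside C merges all of its points in L, which were pairwise inequivalent,
while a piece that reuses a coordinate of C has m-2 more points than needed. *)
Require Import Defs.
From mathcomp Require Import all_boot zify.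

Set Implicit Arguments.
Unset Strict Implicit.
Unset Printing Implicit Defensive.

Lemma leq_mulD a b c p : a <= b + c -> a * p <= b * p + c * p.
Proof. by move=> abc; rewrite -mulnDl leq_mul2r abc orbT. Qed.

(** * Parity on boxes, varying coordinates, fibers *)

Section Octahedral.

Variables (T : finType) (n m : nat) (V : 'I_n -> {set T}).
Hypothesis cardV : forall i, #|V i| = m.
Hypothesis m_ge2 : 2 <= m.

Local Notation F := {ffun 'I_n -> T}.
Implicit Types (A B P L : {set F}) (C J : {set 'I_n}) (D : seq {set F}).
Implicit Types (X : 'I_n -> {set T}) (i j : 'I_n) (f g : F).

(* The sides of the box outside [J] are arbitrary, so for [J = setT] this is the
   parity condition of [octahedral_system], and it weakens as [J] grows. *)
Definition even_on J A : Prop := forall X,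
  (forall i, i \in J -> X i \subset V i) -> (forall i, i \in J -> #|X i| = 2) ->
  ~~ odd #|A :&: class_prod X|.

Definition varying A : {set 'I_n} :=
  [set i | [exists f in A, exists g in A, f i != g i]].

Definition fiber A i v : {set F} := [set f in A | f i == v].

Definition upd X i (S : {set T}) : 'I_n -> {set T} :=
  fun l => if l == i then S else X l.

Definition symdiff A B := (A :\: B) :|: (B :\: A).

Lemma varyingPn A i f g : i \notin varying A -> f \in A -> g \in A -> f i = g i.
Proof.
move=> iA fA gA; apply/eqP; apply: contraNT iA => fg.
by rewrite inE; apply/existsP; exists f; rewrite fA; apply/existsP; exists g; rewrite gA.
Qed.

Lemma varying_subP A J :
  reflect (forall i f g, i \notin J -> f \in A -> g \in A -> f i = g i)
          (varying A \subset J).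
Proof.
apply: (iffP subsetP) => [sAJ i f g iJ fA gA | H i].
  by apply: varyingPn fA gA; apply: contraNN iJ; apply: sAJ.
apply: contraTT => iJ; rewrite inE negb_exists; apply/forallP => f.
rewrite negb_and; case: (boolP (f \in A)) => //= fA.
rewrite negb_exists; apply/forallP => g; rewrite negb_and.
by case: (boolP (g \in A)) => //= gA; rewrite negbK (H i f g).
Qed.

Lemma varyingS A B : A \subset B -> varying A \subset varying B.
Proof.
move=> /subsetP sAB; apply/varying_subP => i f g iB /sAB fB /sAB gB.
exact: varyingPn iB fB gB.
Qed.

Lemma class_prodP X f : reflect (forall i, f i \in X i) (f \in class_prod X).
Proof. by rewrite inE; apply: forallP. Qed.

Lemma even_onS J J' A : J \subset J' -> even_on J A -> even_on J' A.
Proof.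
move=> /subsetP sJ oA X sX cX; apply: oA => i /sJ; [exact: sX | exact: cX].
Qed.

Lemma odd_card_symdiff A B (C : {set F}) :
  odd #|symdiff A B :&: C| = odd #|A :&: C| (+) odd #|B :&: C|.
Proof.
rewrite /symdiff setIUl cardsU.
have -> : ((A :\: B) :&: C) :&: ((B :\: A) :&: C) = set0.
  by apply/setP => f; rewrite !inE; do !case: (_ \in _).
rewrite cards0 subn0 oddD -(cardsID B (A :&: C)) -(cardsID A (B :&: C)) !oddD.
have -> : A :&: C :&: B = B :&: C :&: A.
  by apply/setP => f; rewrite !inE; do !case: (_ \in _).
have -> : A :&: C :\: B = (A :\: B) :&: C.
  by apply/setP => f; rewrite !inE; do !case: (_ \in _).
have -> : B :&: C :\: A = (B :\: A) :&: C.
  by apply/setP => f; rewrite !inE; do !case: (_ \in _).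
by case: (odd _); case: (odd _); case: (odd _).
Qed.

Lemma card_symdiff A L : #|A| + 2 * #|symdiff A L :&: L| = #|L| + #|symdiff A L|.
Proof.
have -> : symdiff A L :&: L = L :\: A.
  by apply/setP => f; rewrite !inE; do !case: (_ \in _).
rewrite /symdiff cardsU.
have -> : (A :\: L) :&: (L :\: A) = set0.
  by apply/setP => f; rewrite !inE; do !case: (_ \in _).
rewrite cards0 subn0; have := cardsID L A; have := cardsID A L.
rewrite [L :&: A]setIC; lia.
Qed.

Lemma card_fibers A i : A \subset class_prod V ->
  #|A| = \sum_(v in V i) #|fiber A i v|.
Proof.
move=> /subsetP sAV; rewrite -sum1_card (partition_big (fun f => f i) (mem (V i))) /=.
  by apply: eq_bigr => v _; rewrite -sum1_card; apply: eq_bigl => f; rewrite !inE.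
by move=> f /sAV /class_prodP.
Qed.

Lemma fiber_sub A i v : fiber A i v \subset A.
Proof. by apply/subsetP => f; rewrite inE => /andP[]. Qed.

Lemma varying_fiber A J i v : varying A \subset J -> varying (fiber A i v) \subset J :\ i.
Proof.
move=> sJ; apply/varying_subP => l f g; rewrite !inE negb_and negbK.
case/orP => [/eqP->|lJ] /andP[fA /eqP fv] /andP[gA /eqP gv]; first by rewrite fv gv.
by move/varying_subP: sJ => /(_ l f g lJ fA gA).
Qed.

(** Since the fiber over [v] is empty, a box with side [{v, w}] at [j] meets [A] only in the fiber
    over [w]; thus side [j] of the test box may be arbitrary. *)
Lemma even_on_fiber J A j v w : even_on J A -> v \in V j -> w \in V j ->
  fiber A j v = set0 -> even_on (J :\ j) (fiber A j w).
Proof.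
move=> oA vV wV Av0 X sX cX.
have [wv|wv] := eqVneq w v; first by rewrite wv Av0 set0I cards0.
have [wX|wX] := boolP (w \in X j); last first.
  have -> : fiber A j w :&: class_prod X = set0; last by rewrite cards0.
  apply/eqP; rewrite -subset0; apply/subsetP => f /setIP[].
  by rewrite inE => /andP[_ /eqP fw] /class_prodP/(_ j); rewrite fw (negbTE wX).
have -> : fiber A j w :&: class_prod X = A :&: class_prod (upd X j [set v; w]).
  apply/setP => f; rewrite !inE; apply/idP/idP.
    case/andP => /andP[fA /eqP fw] /forallP fX; rewrite fA; apply/forallP => l.
    by rewrite /upd; case: eqP => [->|_ //]; rewrite fw !inE eqxx orbT.
  case/andP => fA /forallP fX; rewrite fA /=.
  have fw : f j == w.
    have := fX j; rewrite /upd eqxx !inE => /orP[fv|//].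
    by have : f \in fiber A j v; [rewrite inE fA | rewrite Av0 inE].
  rewrite fw; apply/forallP => l; have := fX l; rewrite /upd.
  by case: (eqVneq l j) => // ->; rewrite (eqP fw).
apply: oA => l lJ; rewrite /upd; case: (eqVneq l j) => lj.
- by rewrite lj; apply/subsetP => t; rewrite !inE => /orP[/eqP->|/eqP->].
- by apply: sX; rewrite !inE lj.
- by rewrite cards2 eq_sym wv.
- by apply: cX; rewrite !inE lj.
Qed.

(** * Perfect systems and the splitting into them *)

(** Parity is required even for boxes with arbitrary sides at the constant coordinates, so [P]
    behaves as a system in its varying coordinates only. *)
Definition perfect P : Prop :=
  [/\ P != set0, P \subset class_prod V, even_on (varying P) P
    & forall i, i \in varying P -> class_covered V P i].

(* [A] is the disjoint union of the members of [D]. *)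
Definition splits A D : Prop := forall B, #|A :&: B| = \sum_(P <- D) #|P :&: B|.

Lemma splits_card A D : splits A D -> #|A| = \sum_(P <- D) #|P|.
Proof.
by move=> /(_ setT); rewrite setIT => ->; apply: eq_bigr => P _; rewrite setIT.
Qed.

Lemma splits_sub A D P : splits A D -> P \in D -> P \subset A.
Proof.
move=> sA PD; apply/subsetP => f fP.
have := sA [set f]; rewrite (big_rem P) //=.
have -> : P :&: [set f] = [set f] by apply/setIidPr; rewrite sub1set.
rewrite cards1 => H; have : 0 < #|A :&: [set f]| by rewrite H.
by case/card_gt0P => g; rewrite !inE => /andP[gA /eqP <-].
Qed.

Lemma splits_mem A D f : splits A D -> f \in A -> exists2 P, P \in D & f \in P.
Proof.
move=> sA fA; apply/hasP; apply: contraTT fA => /hasPn noP.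
have : #|A :&: [set f]| = 0.
  rewrite sA big_seq big1 // => P /noP fP; apply/eqP; rewrite cards_eq0.
  by apply/eqP/setP => g; rewrite !inE; case: eqP => [->|]; rewrite ?andbT ?andbF ?(negbTE fP).
by move/eqP; rewrite cards_eq0 => /eqP/setP/(_ f); rewrite !inE eqxx andbT => ->.
Qed.

(** If an element of some class of [J] is uncovered, a nonempty fiber over that class splits off:
    the fiber loses a coordinate of [J], the rest loses points. If none is, [A] itself is
    perfect. *)
Lemma perfect_splitting J A : A \subset class_prod V -> varying A \subset J ->
  even_on J A -> exists2 D, splits A D & forall P, P \in D -> perfect P.
Proof.
have [k] := ubnP (#|A| + #|J|); elim: k => // k IH in J A *.
rewrite ltnS => le_k sAV vAJ oA.
have [->|[f0 f0A]] := set_0Vmem A.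
  by exists [::] => // B; rewrite set0I cards0 big_nil.
case: (boolP [exists j in J, exists v in V j, fiber A j v == set0]); last first.
  rewrite negb_exists => /forallP noU.
  have cov j : j \in J -> class_covered V A j.
    move=> jJ v vV; have := noU j; rewrite jJ negb_exists => /forallP/(_ v).
    by rewrite vV => /set0Pn[f]; rewrite inE => /andP[fA /eqP fv]; exists f.
  (* A covered class has at least two elements, so its coordinate varies. *)
  have JA : J = varying A.
    apply/eqP; rewrite eqEsubset vAJ andbT; apply/subsetP => j jJ.
    have /card_gt1P[v [w [vV wV vw]]] : 1 < #|V j| by rewrite cardV.
    have [f fA fv] := cov j jJ v vV; have [g gA gw] := cov j jJ w wV.
    apply: contraNT vw => jA; apply/eqP.
    by rewrite -fv -gw; apply: varyingPn jA fA gA.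
  exists [:: A]; first by move=> B; rewrite big_seq1.
  move=> P; rewrite inE => /eqP->; split; rewrite -?JA //.
  by apply/set0Pn; exists f0.
case/existsP => j /andP[jJ] /existsP[v] /andP[vV /eqP Av0].
set w := f0 j; set B := fiber A j w.
have wV : w \in V j by have := subsetP sAV _ f0A => /class_prodP/(_ j).
have oB : even_on (J :\ j) B := even_on_fiber oA vV wV Av0.
have vB : varying B \subset J :\ j := varying_fiber j w vAJ.
have sBA : B \subset A := fiber_sub A j w.
have f0B : f0 \in B by rewrite inE f0A eqxx.
have cJ : #|J| = (#|J :\ j|).+1 by rewrite (cardsD1 j J) jJ.
have cBA : #|B| <= #|A| := subset_leq_card sBA.
have cA : #|A| = #|B| + #|A :\: B|.
  by rewrite -(cardsID B A); have/setIidPr -> := sBA.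
have cB : 0 < #|B| by apply/card_gt0P; exists f0.
have [|D1 sD1 pD1] := IH (J :\ j) B _ (subset_trans sBA sAV) vB oB.
  by apply: leq_trans le_k; rewrite cJ addnS ltnS leq_add2r.
have [||||D2 sD2 pD2] := IH J (A :\: B).
- by apply: leq_trans le_k; rewrite ltn_add2r cA -[X in X < _]add0n ltn_add2r.
- exact: subset_trans (subsetDl _ _) sAV.
- exact: subset_trans (varyingS (subsetDl _ _)) vAJ.
- move=> X sX cX.
  have := oA X sX cX; rewrite -(cardsID B (A :&: class_prod X)) oddD.
  have -> : A :&: class_prod X :&: B = B :&: class_prod X.
    by rewrite setIAC; have/setIidPr -> := sBA.
  have /negbTE-> := even_onS (subsetDl _ _) oB sX cX.
  by rewrite setIDAC.
exists (D1 ++ D2); last by move=> P; rewrite mem_cat => /orP[/pD1|/pD2].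
move=> X; rewrite big_cat /= -sD1 -sD2 -(cardsID B (A :&: X)).
by rewrite setIAC; have/setIidPr -> := sBA; rewrite setIDAC.
Qed.

Lemma card_perfect_ge P : perfect P -> m <= #|P|.
Proof.
case=> P0 sPV oP cov; have [v0|[j jP]] := set_0Vmem (varying P).
  (* With nothing varying, parity applies to the full box, yet [P] is a single point. *)
  have /negP[] : ~~ odd #|P :&: class_prod (fun=> setT)|.
    by apply: oP => i; rewrite v0 inE.
  have -> : P :&: class_prod (fun=> setT) = P.
    by apply/setIidPl/subsetP => f _; apply/class_prodP => i; rewrite inE.
  have/set0Pn[f fP] := P0.
  suff -> : P = [set f] by rewrite cards1.
  apply/setP => g; rewrite inE; apply/idP/eqP => [gP|-> //].
  by apply/ffunP => i; apply: varyingPn gP fP; rewrite v0 inE.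
rewrite -(cardV j); apply: leq_trans (leq_imset_card (fun f => f j) (mem P)).
apply: subset_leq_card; apply/subsetP => v vV.
by have [f fP <-] := cov j jP v vV; apply: imset_f.
Qed.

Lemma card_even_on_ge J A : A \subset class_prod V -> varying A \subset J ->
  even_on J A -> A != set0 -> m <= #|A|.
Proof.
move=> sAV vA oA /set0Pn[f fA].
have [D sD pD] := perfect_splitting sAV vA oA.
have [P PD _] := splits_mem sD fA.
exact: leq_trans (card_perfect_ge (pD P PD)) (subset_leq_card (splits_sub sD PD)).
Qed.

Lemma card_large_fibers A j : A \subset class_prod V ->
  (forall v, v \in V j -> m <= #|fiber A j v|) -> m * m <= #|A|.
Proof.
move=> sAV big; rewrite (card_fibers j sAV) -{1}(cardV j) -sum_nat_const.
exact: leq_sum.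
Qed.

(** * Classes of points modulo a set of coordinates *)

Definition forget C (u : {ffun 'I_n -> option T}) : {ffun 'I_n -> option T} :=
  [ffun i => if i \in C then None else u i].

(** [None] marks a dropped coordinate, so tuples agreeing outside [C] have equal images. *)
Definition restrict C f : {ffun 'I_n -> option T} :=
  [ffun i => if i \in C then None else Some (f i)].

(* The number of classes of [L] modulo agreement outside [C]. *)
Definition classes C L := #|restrict C @: L|.

Lemma forget_restrict C C' f : C \subset C' -> forget C' (restrict C f) = restrict C' f.
Proof.
move=> /subsetP sC; apply/ffunP => i; rewrite !ffunE.
by case: ifPn => // iC; case: ifPn => // /sC; rewrite (negbTE iC).
Qed.

Lemma classes_forget C C' L : C \subset C' ->
  restrict C' @: L = forget C' @: (restrict C @: L).
Proof.
by move=> sC; rewrite -imset_comp; apply: eq_imset => f /=; rewrite forget_restrict.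
Qed.

Lemma leq_classes C C' L : C \subset C' -> classes C' L <= classes C L.
Proof. by move=> sC; rewrite /classes (classes_forget L sC) leq_imset_card. Qed.

Lemma classes_gt0 C L : L != set0 -> 0 < classes C L.
Proof.
case/set0Pn => f fL; apply/card_gt0P; exists (restrict C f); exact: imset_f.
Qed.

Lemma restrict_const C P f g : varying P \subset C -> f \in P -> g \in P ->
  restrict C f = restrict C g.
Proof.
move=> /varying_subP vP fP gP; apply/ffunP => i; rewrite !ffunE.
by case: ifPn => // iC; rewrite (vP i f g).
Qed.

Lemma card_restrict_const C P (Q : {set F}) : varying P \subset C -> Q \subset P ->
  #|restrict C @: Q| <= 1.
Proof.
move=> vP /subsetP sQ; apply/card_le1_eqP => _ _ /imsetP[f fQ ->] /imsetP[g gQ ->].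
by apply: (@restrict_const C P) => //; apply: sQ.
Qed.

(** Points of [P] agree on [C], so those in [L] are pairwise inequivalent modulo [C]; dropping
    [varying P] as well merges them into one class. *)
Lemma classes_disjoint C P L : [disjoint varying P & C] ->
  classes (C :|: varying P) L + #|P :&: L|.-1 <= classes C L.
Proof.
move=> dPC; set C' := C :|: varying P; set Q := P :&: L.
have sC : C \subset C' by apply: subsetUl.
have cQ : #|restrict C @: Q| = #|Q|.
  apply: card_in_imset => f g /setIP[fP _] /setIP[gP _] /ffunP fg.
  apply/ffunP => i; have := fg i; rewrite !ffunE; case: ifPn => [iC _|_ [//]].
  by apply: varyingPn fP gP; rewrite (disjointFl dPC iC).
have sQ : restrict C @: Q \subset restrict C @: L by apply: imsetS; apply: subsetIr.
have cL : #|restrict C @: L| = #|Q| + #|restrict C @: L :\: restrict C @: Q|.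
  by rewrite -(cardsID (restrict C @: Q) (restrict C @: L)); have/setIidPr -> := sQ; rewrite cQ.
have cQ' : #|restrict C' @: Q| <= 1.
  by apply: (@card_restrict_const C' P); [apply: subsetUr | apply: subsetIl].
have [Q0|Q0] := posnP #|Q|; first by rewrite Q0 addn0 leq_classes.
rewrite /classes cL (classes_forget L sC).
have -> : forget C' @: (restrict C @: L) = restrict C' @: Q :|:
    forget C' @: (restrict C @: L :\: restrict C @: Q).
  rewrite (classes_forget Q sC) -imsetU; congr (forget C' @: _).
  by rewrite -{1}(setID (restrict C @: L) (restrict C @: Q)); have/setIidPr -> := sQ.
set S := restrict C @: L :\: restrict C @: Q.
have cS : #|forget C' @: S| <= #|S| := leq_imset_card _ _.
have := (leq_card_setU (restrict C' @: Q) (forget C' @: S)).1.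
move: cS cQ' Q0; lia.
Qed.

(** * Cost of the overlaps between [L] and the pieces *)

Definition directions D : {set 'I_n} := \bigcup_(P <- D) varying P.

Lemma card_setUD C (A B : {set 'I_n}) :
  #|(A :|: B) :\: C| <= #|A :\: C| + #|B :\: (C :|: A)|.
Proof.
apply: leq_trans (leq_card_setU (A :\: C) (B :\: (C :|: A))).
apply: subset_leq_card; apply/subsetP => i; rewrite !inE.
by do !case: (_ \in _).
Qed.

(** The bound to be proved for perfect systems, assumed of the pieces in the induction. *)
Definition heavy P := #|varying P| * (m - 2) + 2 <= #|P|.

(** If [varying P] avoids [C], the merged classes pay for the overlap. Otherwise a repeated
    coordinate saves [m - 2], which with [#|L| < m] pays for all but [#|P :&: L|.-1]. *)
Lemma piece_cost C P L : heavy P -> #|L| < m ->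
  #|varying P :\: C| * (m - 2) + 2 * #|P :&: L| + 2 * classes (C :|: varying P) L
  <= #|P| + 2 * classes C L + #|P :&: L|.-1.
Proof.
rewrite /heavy => hP Lm.
have iL : #|P :&: L| <= #|L| by apply: subset_leq_card; apply: subsetIr.
have [dPC|] := boolP [disjoint varying P & C].
  have := classes_disjoint L dPC; have/setDidPl -> := dPC; lia.
rewrite -setI_eq0 -card_gt0 => oPC.
have := leq_classes L (subsetUl C (varying P)).
have := cardsID C (varying P); move: hP oPC; nia.
Qed.

Lemma pieces_cost C D L : (forall P, P \in D -> heavy P) -> #|L| < m ->
  #|directions D :\: C| * (m - 2) + 2 * (\sum_(P <- D) #|P :&: L|)
    + 2 * classes (C :|: directions D) L
  <= \sum_(P <- D) #|P| + 2 * classes C L + \sum_(P <- D) #|P :&: L|.-1.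
Proof.
rewrite /directions; elim: D C => [|P D IH] C hD Lm.
  by rewrite !big_nil set0D cards0 setU0; lia.
rewrite !big_cons; have hP : heavy P by apply: hD; rewrite mem_head.
have := IH (C :|: varying P) (fun Q QD => hD Q (@mem_behead _ (P :: _) Q QD)) Lm.
have := piece_cost C hP Lm; rewrite -setUA.
have := leq_mulD (m - 2) (card_setUD C (varying P) (\bigcup_(Q <- D) varying Q)).
lia.
Qed.

Lemma sum_predn D L : \sum_(P <- D) #|P :&: L|.-1 <= (\sum_(P <- D) #|P :&: L|).-1.
Proof. by elim: D => [|P D IH]; rewrite ?big_nil // !big_cons; lia. Qed.

Lemma card_directions D : (forall P, P \in D -> heavy P) ->
  #|directions D| * (m - 2) + 2 * size D <= \sum_(P <- D) #|P|.
Proof.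
rewrite /directions; elim: D => [|P D IH] hD; first by rewrite !big_nil cards0.
rewrite !big_cons [size _]/=.
have := IH (fun Q QD => hD Q (@mem_behead _ (P :: _) Q QD)).
have := hD P (mem_head _ _); rewrite /heavy.
have := leq_mulD (m - 2) (leq_card_setU (varying P) (\bigcup_(Q <- D) varying Q)).1.
by lia.
Qed.

(* Unlike in [family_cost], there is no term [#|L|.-1]: starting from [C = set0]
   all points of [L] are inequivalent, even if the pieces share coordinates. *)
Lemma first_pieces_cost D L A : splits A D -> (forall P, P \in D -> heavy P) ->
  #|directions D| * (m - 2) + 2 * #|A :&: L| + 2 * classes (directions D) L
  <= #|A| + 2 * #|L|.
Proof.
move=> sD hD; set C := directions D.
have cD : #|C| * (m - 2) + 2 * size D <= #|A|.
  by rewrite (splits_card sD) card_directions.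
(* Each piece varies only inside [C] and so lies in one class: [A :&: L] has at most [size D]
   classes, paid for by the term [2 * size D] of [cD]. *)
have merge D' (Q : {set F}) : (forall P, P \in D' -> varying P \subset C) ->
    (forall f, f \in Q -> exists2 P, P \in D' & f \in P) ->
    #|restrict C @: Q| <= size D'.
  elim: D' Q => [|P D' IH] Q vD QD.
    have -> : Q = set0; last by rewrite imset0 cards0.
    by apply/setP => f; rewrite inE; apply/negP => /QD[].
  rewrite -(setID Q P) imsetU /=.
  apply: leq_trans (leq_card_setU _ _) _; rewrite -add1n leq_add //.
    by apply: (@card_restrict_const C P); [apply: vD; rewrite mem_head | apply: subsetIr].
  apply: IH => [R RD|f /setDP[fQ fP]]; first by apply: vD; rewrite inE RD orbT.
  have [R] := QD f fQ; rewrite inE => /orP[/eqP-> fP'|RD fR]; last by exists R.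
  by rewrite fP' in fP.
have cAL : #|restrict C @: (L :&: A)| <= size D.
  apply: merge => [P PD|f /setIP[_ fA]]; last exact: (splits_mem sD fA).
  by rewrite /C /directions (big_rem P) //= subsetUl.
have cLA : #|restrict C @: (L :\: A)| <= #|L :\: A| := leq_imset_card _ _.
have cU : classes C L <= #|restrict C @: (L :&: A)| + #|restrict C @: (L :\: A)|.
  by rewrite /classes -{1}(setID L A) imsetU leq_card_setU.
have cL : #|A :&: L| + #|L :\: A| = #|L| by rewrite setIC cardsID.
by lia.
Qed.

(** The pieces of one [D] are disjoint, so their penalties add up to at most [#|L|.-1]: one such
    term per list, however many pieces it has. *)
Lemma family_cost (Ds : seq (seq {set F})) C L :
  (forall D, D \in Ds -> forall P, P \in D -> heavy P) ->
  (forall D, D \in Ds -> exists A, splits A D) -> #|L| < m ->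
  #|directions (flatten Ds) :\: C| * (m - 2)
    + 2 * (\sum_(D <- Ds) \sum_(P <- D) #|P :&: L|)
    + 2 * classes (C :|: directions (flatten Ds)) L
  <= \sum_(D <- Ds) \sum_(P <- D) #|P| + 2 * classes C L + size Ds * #|L|.-1.
Proof.
elim: Ds C => [|D Ds IH] C hD sD Lm.
  by rewrite !big_nil /directions /= big_nil set0D cards0 setU0; lia.
rewrite !big_cons [size _]/= [flatten _]/=.
have -> : directions (D ++ flatten Ds) = directions D :|: directions (flatten Ds).
  by rewrite /directions big_cat.
have sub E : E \in Ds -> E \in D :: Ds by rewrite inE orbC => ->.
have := IH (C :|: directions D) (fun E ED => hD E (sub E ED))
  (fun E ED => sD E (sub E ED)) Lm.
have := pieces_cost C (hD D (mem_head _ _)) Lm; rewrite -setUA.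
have := leq_mulD (m - 2) (card_setUD C (directions D) (directions (flatten Ds))).
have [A sA] := sD D (mem_head _ _).
have := sum_predn D L; rewrite -sA.
have : #|A :&: L| <= #|L| by apply: subset_leq_card; apply: subsetIr.
by nia.
Qed.

(** * Links and their differences *)

Definition shift i x f : F := [ffun l => if l == i then x else f l].

(** The link of [y] keeps coordinate [i], reset to [x], so that links of different elements lie in
    the same product and can be compared. *)
Definition link A i x y : {set F} := shift i x @: fiber A i y.

Lemma link_inj A i x y : {in fiber A i y &, injective (shift i x)}.
Proof.
move=> f g; rewrite !inE => /andP[_ /eqP fy] /andP[_ /eqP gy] /ffunP fg.
apply/ffunP => l; have := fg l; rewrite !ffunE.
by case: eqP => // ->; rewrite fy gy.
Qed.

Lemma card_link A i x y : #|link A i x y| = #|fiber A i y|.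
Proof. exact: card_in_imset (@link_inj A i x y). Qed.

Lemma link_id A i x : link A i x x = fiber A i x.
Proof.
rewrite -[RHS]imset_id /link; apply: eq_in_imset => f.
rewrite inE => /andP[_ /eqP fx]; apply/ffunP => l; rewrite ffunE.
by case: eqP => // ->.
Qed.

Lemma card_linkI A i x y X : x \in X i ->
  #|link A i x y :&: class_prod X| = #|fiber A i y :&: class_prod (upd X i setT)|.
Proof.
move=> xX; rewrite -[RHS](card_in_imset (f := shift i x)); last first.
  by move=> f g /setIP[fA _] /setIP[gA _]; apply: link_inj fA gA.
congr #|pred_of_set _|; apply/setP => f; apply/setIP/imsetP => [[/imsetP[g gA ->]]|[g]].
  move=> /class_prodP gX; exists g => //; apply/setIP; split=> //.
  apply/class_prodP => l; rewrite /upd; case: eqP => [_|/eqP li]; first by rewrite inE.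
  by have := gX l; rewrite ffunE (negbTE li).
case/setIP => gA /class_prodP gX ->; split; first exact: imset_f.
apply/class_prodP => l; rewrite ffunE; case: eqP => [-> //|/eqP li].
by have := gX l; rewrite /upd (negbTE li).
Qed.

Lemma card_two_fibers A i a b X : a != b ->
  #|A :&: class_prod (upd X i [set a; b])| =
  #|fiber A i a :&: class_prod (upd X i setT)|
  + #|fiber A i b :&: class_prod (upd X i setT)|.
Proof.
move=> ab; rewrite -(cardsID (fiber A i a)).
congr (_ + _); apply: eq_card => f; rewrite !inE.
  have [fA|] := boolP (f \in A); rewrite ?andbF //=.
  have [fa|] := eqVneq (f i) a; rewrite ?andbF //= andbT.
  apply: eq_forallb => l; rewrite /upd; case: eqP => // ->.
  by rewrite !inE fa eqxx.
have [fA|] := boolP (f \in A); rewrite ?andbF //=.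
have [fa|fa] := eqVneq (f i) a; rewrite /= ?fa ?(negbTE ab) //.
have [fb|fb] := eqVneq (f i) b => /=.
  apply: eq_forallb => l; rewrite /upd; case: eqP => // ->.
  by rewrite !inE fb eqxx orbT.
by apply/forallP => /(_ i); rewrite /upd eqxx !inE (negbTE fa) (negbTE fb).
Qed.

Lemma link_coord A i x y f : f \in link A i x y -> f i = x.
Proof. by case/imsetP => g _ ->; rewrite ffunE eqxx. Qed.

Lemma varying_link A J i x y : varying A \subset J ->
  varying (symdiff (link A i x y) (link A i x x)) \subset J :\ i.
Proof.
move=> /varying_subP vA; apply/varying_subP => l f g lJ fS gS.
have lk h : h \in symdiff (link A i x y) (link A i x x) ->
    h i = x /\ exists2 h', h' \in A & forall l, l != i -> h l = h' l.
  rewrite !inE => /orP[] /andP[_ hl]; split; try exact: link_coord hl;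
    case/imsetP: hl => h'; rewrite inE => /andP[h'A _] ->; exists h' => // l' ne;
    by rewrite ffunE (negbTE ne).
have [fi [f' f'A ff']] := lk f fS; have [gi [g' g'A gg']] := lk g gS.
have [->|li] := eqVneq l i; first by rewrite fi gi.
rewrite ff' // gg' //; apply: vA => //.
by apply: contraNN lJ => lJ; rewrite !inE li.
Qed.

Lemma link_sub A i x y : A \subset class_prod V -> x \in V i ->
  link A i x y \subset class_prod V.
Proof.
move=> /subsetP sA xV; apply/subsetP => _ /imsetP[g gA ->].
apply/class_prodP => l; rewrite ffunE; case: eqP => [->//|_].
by move: gA; rewrite inE => /andP[/sA/class_prodP].
Qed.

(** For a box with [x] in side [i], the two links together have as many points in it as [A] has in
    the box with side [{y, x}] at [i]; otherwise both miss the box. *)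
Lemma even_on_link A J i x y : even_on J A -> x \in V i -> y \in V i ->
  even_on (J :\ i) (symdiff (link A i x y) (link A i x x)).
Proof.
move=> oA xV yV X sX cX; rewrite odd_card_symdiff.
have [->|yx] := eqVneq y x; first by rewrite addbb.
have [xX|xX] := boolP (x \in X i); last first.
  have z w : link A i x w :&: class_prod X = set0.
    apply/eqP; rewrite -subset0; apply/subsetP => f /setIP[/link_coord fx].
    by move=> /class_prodP/(_ i); rewrite fx (negbTE xX).
  by rewrite !z addbb.
rewrite !card_linkI // -oddD -card_two_fibers //.
apply: oA => l lJ; rewrite /upd; case: (eqVneq l i) => li.
- by rewrite li; apply/subsetP => t; rewrite !inE => /orP[/eqP->|/eqP->].
- by apply: sX; rewrite !inE li.
- by rewrite cards2 yx.
- by apply: cX; rewrite !inE li.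
Qed.

(** No piece varies in [i] or [j], so pieces meet evenly even boxes with side [{v}] at [j] and full
    side at [i]. All links then have the same parity in such a box, and two of them add up to an
    even number. *)
Lemma even_on_constant_fiber A J i j x v (D : T -> seq {set F}) :
  i \in J -> j != i -> x \in V i -> even_on J A ->
  (forall y, y \in V i -> splits (symdiff (link A i x y) (link A i x x)) (D y)) ->
  (forall y P, y \in V i -> P \in D y -> even_on (varying P) P) ->
  (forall y P, y \in V i -> P \in D y -> varying P \subset J :\ i :\ j) ->
  even_on (J :\ j) (fiber A j v).
Proof.
move=> iJ ji xV oA sD eD vD X sX cX.
have [vX|vX] := boolP (v \in X j); last first.
  have -> : fiber A j v :&: class_prod X = set0; last by rewrite cards0.
  apply/eqP; rewrite -subset0; apply/subsetP => f /setIP[].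
  by rewrite inE => /andP[_ /eqP fv] /class_prodP/(_ j); rewrite fv (negbTE vX).
have iJj : i \in J :\ j by rewrite !inE eq_sym ji.
have /eqP/cards2P[a [b [ab Xi]]] := cX i iJj.
have sXi := sX i iJj; rewrite Xi in sXi.
have aV : a \in V i by apply: (subsetP sXi); rewrite !inE eqxx.
have bV : b \in V i by apply: (subsetP sXi); rewrite !inE eqxx orbT.
pose Z := upd (upd X j [set v]) i setT.
have -> : fiber A j v :&: class_prod X
    = A :&: class_prod (upd (upd X j [set v]) i [set a; b]).
  apply/setP => f; rewrite !inE -andbA; case: (f \in A) => //=.
  apply/idP/idP.
    case/andP => /eqP fv /forallP fX; apply/forallP => l; rewrite /upd.
    case: eqP => [->|_]; first by rewrite -Xi.
    by case: eqP => // ->; rewrite inE fv.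
  move=> /forallP fX; have /eqP fv : f j == v.
    by have := fX j; rewrite /upd (negbTE ji) eqxx inE.
  rewrite fv eqxx /=; apply/forallP => l; have := fX l; rewrite /upd.
  case: eqP => [->|_]; first by rewrite Xi.
  by case: eqP => // ->; rewrite fv.
have even_diff y : y \in V i ->
    odd #|fiber A i y :&: class_prod Z| = odd #|fiber A i x :&: class_prod Z|.
  move=> yV; have updZ : class_prod (upd Z i setT) = class_prod Z.
    apply/setP => f; rewrite !inE; apply: eq_forallb => l; rewrite /Z /upd.
    by case: eqP.
  have xZ : x \in Z i by rewrite /Z /upd eqxx inE.
  have : ~~ odd #|symdiff (link A i x y) (link A i x x) :&: class_prod Z|.
    rewrite (sD y yV) big_seq; apply: (big_ind (fun k => ~~ odd k)) => //.
      by move=> p q /negbTE op /negbTE oq; rewrite oddD op oq.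
    move=> P PD; apply: (eD y P yV PD) => l /(subsetP (vD y P yV PD));
      rewrite !inE => /and3P[lj li lJ]; rewrite /Z /upd (negbTE li) (negbTE lj);
      [apply: sX | apply: cX]; by rewrite !inE lj.
  by rewrite odd_card_symdiff !card_linkI // updZ negb_add => /eqP.
by rewrite card_two_fibers // oddD !even_diff // addbb.
Qed.

(** * The bound for perfect systems *)

Theorem card_perfect P : #|varying P| <= m -> perfect P -> heavy P.
Proof.
have [k] := ubnP #|varying P|; elim: k => // k IH in P *.
rewrite ltnS => le_k vm pP; have [P0 sPV oP cov] := pP.
set J := varying P in le_k vm oP cov; rewrite /heavy -/J.
have [J0|[i iJ]] := set_0Vmem J.
  by rewrite J0 cards0; apply: leq_trans (card_perfect_ge pP); rewrite add0n.
have [x0 x0V] : exists x0, x0 \in V i by apply/card_gt0P; rewrite cardV; lia.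
case: (arg_minnP (fun y => #|fiber P i y|) x0V) => x xV minx.
set d := #|fiber P i x| in minx.
(* Here [#|J| <= m] and [m * (m - 2) + 2 <= m * m]. *)
have square : m * m <= #|P| -> #|J| * (m - 2) + 2 <= #|P| by nia.
have [md|dm] := leqP m d.
  apply/square/(card_large_fibers sPV) => y yV; exact: leq_trans md (minx y yV).
have d_gt0 : 0 < d.
  have [f fP fx] := cov i iJ x xV.
  by apply/card_gt0P; exists f; rewrite inE fP fx eqxx.
pose o y := symdiff (link P i x y) (link P i x x).
have vo y : varying (o y) \subset J :\ i by apply: varying_link.
have /fin_all_exists[D DP] (y : T) : exists D, y \in V i ->
    splits (o y) D /\ forall Q, Q \in D -> perfect Q.
  have [yV|] := boolP (y \in V i); last by exists [::].
  have so : o y \subset class_prod V.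
    by apply/subsetP => f; rewrite !inE => /orP[] /andP[_];
      move/(subsetP (link_sub _ sPV xV)); rewrite inE.
  by have [D sD pD] := perfect_splitting so (vo y) (even_on_link oP xV yV); exists D.
have sD y (yV : y \in V i) := (DP y yV).1.
have pD y (yV : y \in V i) := (DP y yV).2.
have vD y Q : y \in V i -> Q \in D y -> varying Q \subset J :\ i.
  by move=> yV QD; apply: subset_trans (vo y); apply: varyingS; apply: splits_sub (sD y yV) QD.
have cJ : #|J| = #|J :\ i|.+1 by rewrite (cardsD1 i J) iJ.
have hD y Q : y \in V i -> Q \in D y -> heavy Q.
  move=> yV QD; have := subset_leq_card (vD y Q yV QD) => cQ.
  by apply: IH (pD y yV Q QD); lia.
(* If no piece varies in [j], every fiber over [V j] is nonempty and even on [J :\ j], hence has at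
   least [m] points. *)
case: (boolP [exists j in J :\ i, [forall y in V i, j \notin directions (D y)]]).
  case/existsP => j /andP[jJi /forallP noj].
  have [ji jJ] : j != i /\ j \in J by move: jJi; rewrite !inE => /andP[].
  apply/square/(card_large_fibers (j := j) sPV) => v vV.
  apply: (@card_even_on_ge (J :\ j)).
  - exact: subset_trans (fiber_sub _ _ _) sPV.
  - exact: varying_fiber.
  - apply: (@even_on_constant_fiber P J i j x v D) => //.
      by move=> y Q yV QD; case: (pD y yV Q QD).
    move=> y Q yV QD; rewrite subsetD1 (vD y) //=.
    have := noj y; rewrite yV /=; apply: contraNN => jQ.
    by rewrite /directions (big_rem Q) //= inE jQ.
  - have [f fP fv] := cov j jJ v vV.
    by apply/set0Pn; exists f; rewrite inE fP fv eqxx.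
rewrite negb_exists => /forallP allj.
(* For each other coordinate, one [y] whose difference varies there; [x] is a dummy value. The
   chosen set [Y] then has at most [#|J| - 1] elements. *)
have /fin_all_exists[ysel yselP] (j : 'I_n) : exists y, j \in J :\ i ->
    y \in V i /\ j \in directions (D y).
  have [jJ|] := boolP (j \in J :\ i); last by exists x.
  have := allj j; rewrite jJ negb_forall => /existsP[y].
  by rewrite negb_imply negbK => /andP[yV jy]; exists y.
pose Y := ysel @: (J :\ i).
have sY : Y \subset V i by apply/subsetP => _ /imsetP[j /yselP[yV _] ->].
have cY : #|Y| <= #|J :\ i| := leq_imset_card _ _.
have link_card y : #|fiber P i y| + 2 * #|o y :&: fiber P i x| = d + #|o y|.
  by rewrite -(card_link P i x y) /d -(link_id P i x) card_symdiff.
(* The exact link identity is used on [Y]; elsewhere minimality of [d] suffices. *)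
have total : m * d + \sum_(y <- enum Y) #|o y|
    <= #|P| + 2 * (\sum_(y <- enum Y) #|o y :&: fiber P i x|).
  rewrite (card_fibers i sPV) -(cardV i) !big_enum /= -sum_nat_const.
  rewrite (big_setID Y) [X in _ <= X + _](big_setID Y) /= (setIidPr sY).
  rewrite big_distrr /= addnAC [X in _ <= X]addnAC -!big_split /=.
  rewrite leq_add //; first by apply: leq_sum => y _; rewrite link_card.
  by apply: leq_sum => y /setDP[yV _]; apply: minx.
have L0 : fiber P i x != set0 by rewrite -card_gt0.
(* If [Y] is empty, [i] is the only varying coordinate and [m * d >= m] is enough. *)
case EY: (enum Y) total => [|y ys] total.
  have Y0 : Y = set0 by apply/eqP; rewrite -cards_eq0 cardE EY.
  have Ji0 : #|J :\ i| = 0.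
    apply/eqP; rewrite cards_eq0; apply/eqP/setP => j; rewrite [RHS]inE.
    by apply/negP => jJ; have : ysel j \in Y by [apply: imset_f]; rewrite Y0 inE.
  by move: total; rewrite !big_nil cJ Ji0; nia.
have memY z : z \in y :: ys -> z \in V i.
  by rewrite -EY mem_enum => /(subsetP sY).
have yV : y \in V i by apply: memY; rewrite mem_head.
have memys z : z \in ys -> z \in V i by move=> zy; apply: memY; rewrite inE zy orbT.
(* The first difference incurs no penalty; each of the others costs at most [d.-1]. *)
have first := first_pieces_cost (fiber P i x) (sD y yV) (hD y ^~ yV).
set Ds := [seq D z | z <- ys].
have hDs E : E \in Ds -> forall Q, Q \in E -> heavy Q.
  by move=> /mapP[z /memys zV ->] Q; apply: hD.
have sDs E : E \in Ds -> exists A, splits A E.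
  by move=> /mapP[z /memys zV ->]; exists (o z); apply: sD.
have := family_cost (directions (D y)) hDs sDs dm.
set C := directions (D y); set E := directions (flatten Ds).
rewrite /Ds !big_map size_map.
have -> : \sum_(z <- ys) \sum_(Q <- D z) #|Q :&: fiber P i x|
    = \sum_(z <- ys) #|o z :&: fiber P i x|.
  by rewrite !big_seq; apply: eq_bigr => z /memys zV; rewrite (sD z zV).
have -> : \sum_(z <- ys) \sum_(Q <- D z) #|Q| = \sum_(z <- ys) #|o z|.
  by rewrite !big_seq; apply: eq_bigr => z /memys zV; rewrite (splits_card (sD z zV)).
have cov_dirs : #|J :\ i| <= #|C| + #|E :\: C|.
  apply: leq_trans (leq_card_setU C (E :\: C)); apply: subset_leq_card.
  apply/subsetP => j jJ; have [zV jz] := yselP j jJ.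
  have : ysel j \in y :: ys by rewrite -EY mem_enum imset_f.
  rewrite inE => /orP[/eqP yE|zys]; first by rewrite !inE /C -yE jz.
  suff jE : j \in E by rewrite !inE jE andbT orbN.
  move: jz; rewrite /E /directions !bigcup_seq => /bigcupP[Q QD jQ].
  apply/bigcupP; exists Q => //; apply/flattenP.
  by exists (D (ysel j)) => //; apply: map_f.
(* The class that always survives yields the final [+ 2]. *)
have := classes_gt0 (C :|: E) L0.
have sz : (size ys).+1 <= #|J :\ i| by rewrite -[(size ys).+1]/(size (y :: ys)) -EY -cardE.
move: total first; rewrite !big_cons -/C -/(o y) -/d cJ => total first cl fam.
have pen : size ys * d.-1 <= (m - 2) * d.-1 by apply: leq_mul => //; move: sz vm cJ; clear; lia.
have dirs : #|J :\ i| * (m - 2) <= #|C| * (m - 2) + #|E :\: C| * (m - 2).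
  by rewrite -mulnDl leq_mul2r cov_dirs orbT.
(* The three terms pay for the penalties ([size ys <= m - 2]), for coordinate [i], and for the
   [2 * #|L|] of [first]. *)
have md : m * d = (m - 2) * d.-1 + (m - 2) + 2 * d.
  by rewrite -{1}(subnK m_ge2) -{1}(prednK d_gt0); move: d_gt0; clear; lia.
by move: total first fam pen dirs cl md; clear; lia.
Qed.

(** * From perfect systems to octahedral systems *)

Theorem card_octahedral_ge A (K : {set 'I_n}) : n <= m -> octahedral_system V A ->
  K != set0 -> (forall i, i \in K -> class_covered V A i) ->
  #|K| * (m - 2) + 2 <= #|A|.
Proof.
move=> nm [sAV oA] /set0Pn[i0 i0K] cov.
have lenm C : #|C| <= m by apply: leq_trans nm; rewrite -[X in _ <= X]card_ord max_card.
have evA : even_on setT A.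
  by move=> X sX cX; apply: oA => i; [apply: sX | apply: cX]; rewrite inE.
have [D sD pD] := perfect_splitting sAV (subsetT _) evA.
have hD P : P \in D -> heavy P by move=> /pD; apply: card_perfect.
(* Either the bounds for the pieces add up, or some covered [j] is constant on every piece; then
   each fiber over [V j] contains a whole piece, so at least [m] points. *)
have [/subsetP KD|/subsetPn[j jK jD]] := boolP (K \subset directions D).
  have cK : #|K| <= #|directions D| by apply/subset_leq_card/subsetP.
  (* As [K] is nonempty there is a piece, which supplies the summand 2. *)
  have sz : 0 < size D.
    by have := KD i0 i0K; rewrite /directions; case: (D) => //; rewrite big_nil inE.
  rewrite (splits_card sD); apply: leq_trans (card_directions hD).
  by rewrite leq_add ?leq_mul2r ?cK ?orbT // leq_pmulr.
suff : m * m <= #|A| by have := lenm K; nia.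
apply: (card_large_fibers (j := j) sAV) => v vV.
have [f fA fv] := cov j jK v vV; have [P PD fP] := splits_mem sD fA.
apply: leq_trans (card_perfect_ge (pD P PD)) _; apply: subset_leq_card.
apply/subsetP => g gP; rewrite inE (subsetP (splits_sub sD PD) g gP) -fv.
apply/eqP; apply: varyingPn gP fP; apply: contraNN jD => jP.
by rewrite /directions (big_rem P) //= inE jP.
Qed.

End Octahedral.

Theorem theorem2 (n : nat) (n_ge2 : 2 <= n) (T : finType)
    (V : 'I_n -> {set T})
    (disjV : forall i j : 'I_n, i != j -> [disjoint V i & V j])
    (cardV : forall i : 'I_n, #|V i| = n)
    (Omega : {set {ffun 'I_n -> T}})
    (octOmega : octahedral_system V Omega)
    (k : nat) (k_ge1 : 1 <= k)
    (K : {set 'I_n}) (cardK : #|K| = k)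
    (covK : forall i : 'I_n, i \in K -> class_covered V Omega i) :
  k * (n - 2) + 2 <= #|Omega|.
Proof.
rewrite -cardK; apply: (card_octahedral_ge cardV) => //.
by rewrite -card_gt0 cardK.
Qed.
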